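(* Let $W$ be one of the Weyl groups $W_{A_{n-1}}$, $W_{D_n}$ or $W_{B_n}$. The even center of $\mathbb H_W$ contains $\mathbb C[\eta_1^2,\dots,\eta_n^2]^W$ and $\mathbb C[\xi_1^2,\dots,\xi_n^2]^W$. In particular, $\mathbb H_W$ is module-finite over its even center.
   Context: All algebras are over $\mathbb C$; $[a,b]_+=ab+ba$. The even center of a superalgebra ($\mathbb Z_2$-graded algebra) $A$ is the set of even elements of $A$ that are central in $A$. Superscript $W$ denotes $W$-invariants; $W$ acts on the commutative polynomial algebras $\mathbb C[\eta_1^2,\dots,\eta_n^2]$ and $\mathbb C[\xi_1^2,\dots,\xi_n^2]$ by permuting the indices through $W\to S_n$. Weyl groups: $W_{A_{n-1}}=S_n$, $W_{B_n}$ is the group of signed permutations of $1,\dots,n$, $W_{D_n}$ the subgroup of even signed permutations. $s_{ij}$ is the transposition of $i,j$; $\overline s_{ij}$ is the transposition of $i,j$ coupled with sign changes at $i,j$; $\tau_i$ is the sign change at $i$. $W\to S_n$, $\sigma\mapsto\sigma^*$, is the homomorphism forgetting signs ($s_{ij}^*=\overline s_{ij}^*=s_{ij}$, $\tau_i^*=1$); $S_n$ permutes the indices of the $\xi_j$ and of the $\eta_j$. Let $t,u,v\in\mathbb C$. The odd double affine Hecke algebra $\mathbb H_W$ is generated by $\xi_i,\eta_i$ ($1\le i\le n$) and $\mathbb C W$ subject to: $\eta_i\eta_j=-\eta_j\eta_i$, $\xi_i\xi_j=-\xi_j\xi_i$ ($i\ne j$); $\sigma\xi_j=\xi_j^{\sigma^*}\sigma$,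 $\sigma\eta_j=\eta_j^{\sigma^*}\sigma$ ($\sigma\in W$); and, with $i\ne j$: Type $A_{n-1}$: $[\eta_i,\xi_j]_+=us_{ij}$, $\ [\eta_i,\xi_i]_+=t+u\sum_{k\ne i}s_{ki}$. Types $D_n$, $B_n$: $[\eta_i,\xi_j]_+=u(s_{ij}+\overline s_{ij})$, $\ [\eta_i,\xi_i]_+=t+u\sum_{k\ne i}(s_{ki}+\overline s_{ki})+v\tau_i$, where the term $v\tau_i$ is present only in type $B_n$. It is a superalgebra with $\xi_i,\eta_i$ odd and elements of $W$ even. *)

(* Defs.v *)
From HB Require Import structures.
From mathcomp Require Import all_boot all_order all_algebra all_fingroup.
From mathcomp Require Import boolp.
From mathcomp Require Import generic_quotient.
From mathcomp Require Import mpoly.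

Set Implicit Arguments.
Unset Strict Implicit.
Unset Printing Implicit Defensive.

Import GRing.Theory.
Local Open Scope ring_scope.
Local Open Scope quotient_scope.

(******************************************************************************)
(* Associative unital F-algebras given by generators and relations: the       *)
(* quotient of the formal expressions in the generators by the least          *)
(* congruence that contains the F-algebra axioms and the relations.           *)
(* As nontriviality depends on the relations, the quotient is only made a     *)
(* pzRingType and an lmodType; pscaleAl and pscaleAr are the algebra axioms.  *)
(******************************************************************************)

Inductive term (F G : Type) : Type :=
| TGen of G
| TCst of F
| TAdd of term F G & term F G
| TMul of term F G & term F G.
Arguments TGen {F G}.
Arguments TCst {F G}.

Declare Scope expr_scope.
Delimit Scope expr_scope with expr.
Bind Scope expr_scope with term.
Local Notation "x + y" := (TAdd x y) : expr_scope.
Local Notation "x * y" := (TMul x y) : expr_scope.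

HB.instance Definition _ (F G : Type) := gen_eqMixin (term F G).
HB.instance Definition _ (F G : Type) := gen_choiceMixin (term F G).

Section Presentation.
Variables (F : fieldType) (G : Type) (rel : term F G -> term F G -> Prop).

Inductive cong : term F G -> term F G -> Prop :=
| cong_rel x y : rel x y -> cong x y
| cong_refl x : cong x x
| cong_sym x y : cong x y -> cong y x
| cong_trans x y z : cong x y -> cong y z -> cong x z
| cong_add x x' y y' : cong x x' -> cong y y' -> cong (x + y) (x' + y')
| cong_mul x x' y y' : cong x x' -> cong y y' -> cong (x * y) (x' * y')
| cong_addA x y z : cong (x + (y + z)) (x + y + z)
| cong_addC x y : cong (x + y) (y + x)
| cong_add0 x : cong (TCst 0 + x) x
| cong_mulA x y z : cong (x * (y * z)) (x * y * z)
| cong_mul1l x : cong (TCst 1 * x) x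
| cong_mul1r x : cong (x * TCst 1) x
| cong_mulDl x y z : cong ((x + y) * z) (x * z + y * z)
| cong_mulDr x y z : cong (x * (y + z)) (x * y + x * z)
| cong_mul0 x : cong (TCst 0 * x) (TCst 0)
| cong_cstD a b : cong (TCst (a + b)%R) (TCst a + TCst b)
| cong_cstM a b : cong (TCst (a * b)%R) (TCst a * TCst b)
| cong_cstC a x : cong (TCst a * x) (x * TCst a).

Definition congb (x y : term F G) : bool := `[< cong x y >].

Lemma congb_equiv : equiv_class_of congb.
Proof.
split=> [x|x y|y x z].
- by apply/asboolP; exact: cong_refl.
- by apply/asboolP/asboolP => /cong_sym.
- by move=> /asboolP xy /asboolP yz; apply/asboolP; exact: cong_trans xy yz.
Qed.

Canonical congb_eq_rel := EquivRelPack congb_equiv.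

Definition presented : Type := {eq_quot congb_eq_rel}.

HB.instance Definition _ := Choice.on presented.
HB.instance Definition _ := EqQuotient.on presented.

Implicit Types x y z : presented.

Definition pcst (a : F) : presented := \pi_presented (TCst a).
Definition pgen (g : G) : presented := \pi_presented (TGen g).
Definition padd x y : presented := \pi_presented (TAdd (repr x) (repr y)).
Definition pmul x y : presented := \pi_presented (TMul (repr x) (repr y)).
Definition popp x : presented := pmul (pcst (-1)) x.
Definition pscale (a : F) x : presented := pmul (pcst a) x.

Lemma cong_piP (a b : term F G) : cong a b <-> \pi_presented a = \pi b.
Proof.
by split=> [ab|/eqmodP/asboolP//]; apply/eqmodP/asboolP.
Qed.

Lemma cong_repr (a : term F G) : cong (repr (\pi_presented a)) a.
Proof. by apply/cong_piP; rewrite reprK. Qed.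

Lemma padd_pi (a b : term F G) : padd (\pi a) (\pi b) = \pi_presented (a + b)%expr.
Proof. by apply/cong_piP; apply: cong_add; apply: cong_repr. Qed.

Lemma pmul_pi (a b : term F G) : pmul (\pi a) (\pi b) = \pi_presented (a * b)%expr.
Proof. by apply/cong_piP; apply: cong_mul; apply: cong_repr. Qed.

Lemma paddA : associative padd.
Proof.
elim/quotW=> a; elim/quotW=> b; elim/quotW=> c; rewrite !padd_pi.
by apply/cong_piP; apply: cong_addA.
Qed.

Lemma paddC : commutative padd.
Proof.
elim/quotW=> a; elim/quotW=> b; rewrite !padd_pi.
by apply/cong_piP; apply: cong_addC.
Qed.

Lemma padd0 : left_id (pcst 0) padd.
Proof. by elim/quotW=> a; rewrite padd_pi; apply/cong_piP; apply: cong_add0. Qed.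

Lemma pmulA : associative pmul.
Proof.
elim/quotW=> a; elim/quotW=> b; elim/quotW=> c; rewrite !pmul_pi.
by apply/cong_piP; apply: cong_mulA.
Qed.

Lemma pmul1l : left_id (pcst 1) pmul.
Proof. by elim/quotW=> a; rewrite pmul_pi; apply/cong_piP; apply: cong_mul1l. Qed.

Lemma pmul1r : right_id (pcst 1) pmul.
Proof. by elim/quotW=> a; rewrite pmul_pi; apply/cong_piP; apply: cong_mul1r. Qed.

Lemma pmulDl : left_distributive pmul padd.
Proof.
elim/quotW=> a; elim/quotW=> b; elim/quotW=> c; rewrite !(padd_pi, pmul_pi).
by apply/cong_piP; apply: cong_mulDl.
Qed.

Lemma pmulDr : right_distributive pmul padd.
Proof.
elim/quotW=> a; elim/quotW=> b; elim/quotW=> c; rewrite !(padd_pi, pmul_pi).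
by apply/cong_piP; apply: cong_mulDr.
Qed.

Lemma pmul0 : left_zero (pcst 0) pmul.
Proof. by elim/quotW=> a; rewrite pmul_pi; apply/cong_piP; apply: cong_mul0. Qed.

Lemma pcstD a b : pcst (a + b) = padd (pcst a) (pcst b).
Proof. by rewrite padd_pi; apply/cong_piP; apply: cong_cstD. Qed.

Lemma pcstM a b : pcst (a * b) = pmul (pcst a) (pcst b).
Proof. by rewrite pmul_pi; apply/cong_piP; apply: cong_cstM. Qed.

Lemma pcstC a x : pmul (pcst a) x = pmul x (pcst a).
Proof.
by elim/quotW: x => b; rewrite !pmul_pi; apply/cong_piP; apply: cong_cstC.
Qed.

Lemma paddN : left_inverse (pcst 0) popp padd.
Proof.
by move=> x; rewrite /popp -{2}[x]pmul1l -pmulDl -pcstD addNr pmul0.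
Qed.

HB.instance Definition _ :=
  GRing.isZmodule.Build presented paddA paddC padd0 paddN.

HB.instance Definition _ :=
  GRing.Zmodule_isPzRing.Build presented pmulA pmul1l pmul1r pmulDl pmulDr.

Lemma pscaleA a b x : pscale a (pscale b x) = pscale (a * b) x.
Proof. by rewrite /pscale pcstM pmulA. Qed.

Lemma pscaleDr : right_distributive pscale +%R.
Proof. by move=> a x y; apply: pmulDr. Qed.

Lemma pscaleDl x : {morph pscale^~ x : a b / a + b}.
Proof. by move=> a b; rewrite /pscale pcstD pmulDl. Qed.

HB.instance Definition _ :=
  GRing.Zmodule_isLmodule.Build F presented pscaleA pmul1l pscaleDr pscaleDl.

Lemma pscaleAl a x y : a *: (x * y) = (a *: x) * y.
Proof. exact: pmulA. Qed.

Lemma pscaleAr a x y : a *: (x * y) = x * (a *: y).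
Proof.
rewrite [LHS]pmulA [X in pmul X y = _]pcstC; exact: esym (pmulA _ _ _).
Qed.

End Presentation.

(******************************************************************************)
(* The Weyl groups. The signed index (i, false) is i and (i, true) is -i; a   *)
(* signed permutation is a permutation of the signed indices commuting with   *)
(* the change of sign, so that B_n is a centraliser.                          *)
(******************************************************************************)

Inductive weyl_type := TypeA | TypeB | TypeD.

Section WeylGroups.
Variable n : nat.
Implicit Types (i j : 'I_n) (s : {perm 'I_n * bool}).

Definition negx (x : 'I_n * bool) : 'I_n * bool := (x.1, ~~ x.2).

Lemma negx_inj : injective negx.
Proof. by move=> [i b] [j c] [-> /negb_inj ->]. Qed.

Definition weylB : {group {perm 'I_n * bool}} := 'C[perm negx_inj]%G.

Definition sign_change s i : bool := (s (i, false)).2.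

Definition weylD_set : {set {perm 'I_n * bool}} :=
  [set s in weylB | ~~ odd #|[set i | sign_change s i]|].

Lemma weylBP s :
  reflect (forall x, s (negx x) = negx (s x)) (s \in weylB).
Proof.
apply: (iffP cent1P) => [/permP c x | c].
  by have := c x; rewrite !permM !permE => ->.
by apply/permP => x; rewrite !permM !permE c.
Qed.

Lemma weylB_false s i b :
  s \in weylB -> s (i, b) = ((s (i, false)).1, b (+) sign_change s i).
Proof.
move=> /weylBP c; rewrite /sign_change; case: b => /=; last by case: (s _).
by rewrite -[(i, true)]/(negx (i, false)) c.
Qed.

Lemma forget_inj s : s \in weylB -> injective (fun i => (s (i, false)).1).
Proof.
move=> sB i j eq_ij.
have: s (i, false) = s (j, sign_change s i (+) sign_change s j).
  rewrite [RHS]weylB_false // -eq_ij addbK.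
  by rewrite /sign_change; case: (s _).
by move/perm_inj => [->].
Qed.

Lemma odd_sign_change s :
  odd #|[set i | sign_change s i]| = \big[addb/false]_i sign_change s i.
Proof.
rewrite -sum1dep_card big_mkcond (big_morph odd oddD (erefl _)) /=.
by apply: eq_bigr => i _; case: sign_change.
Qed.

Lemma weylD_group_set : group_set weylD_set.
Proof.
apply/group_setP; split=> [|s r].
  rewrite inE group1 odd_sign_change big1 // => i _.
  by rewrite /sign_change perm1.
rewrite ![_ \in weylD_set]inE !odd_sign_change => /andP[sB sD] /andP[rB rD].
apply/andP; split; first exact: (@groupM _ weylB).
rewrite (eq_bigr (fun i => sign_change s i (+) sign_change r (s (i, false)).1)).
  rewrite big_split /= (negbTE sD) addFb.
  by rewrite (reindex_inj (forget_inj sB)) in rD.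
move=> i _; rewrite {1}/sign_change permM.
by rewrite [s (i, false)]surjective_pairing weylB_false.
Qed.

Canonical weylD : {group {perm 'I_n * bool}} := Group weylD_group_set.

Lemma weylD_subB s : s \in weylD -> s \in weylB.
Proof. by rewrite inE => /andP[]. Qed.

Definition sperm i j : {perm 'I_n * bool} :=
  (tperm (i, false) (j, false) * tperm (i, true) (j, true))%g.
Definition sbarperm i j : {perm 'I_n * bool} :=
  (tperm (i, false) (j, true) * tperm (i, true) (j, false))%g.
Definition tauperm i : {perm 'I_n * bool} := tperm (i, false) (i, true).

Definition weyl (ty : weyl_type) : finGroupType :=
  match ty with
  | TypeA => {perm 'I_n}
  | TypeB => [subg weylB]
  | TypeD => [subg weylD]
  end.

Definition forget (ty : weyl_type) : weyl ty -> 'S_n :=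
  match ty return weyl ty -> 'S_n with
  | TypeA => id
  | TypeB => fun w => perm (forget_inj (subgP w))
  | TypeD => fun w => perm (forget_inj (weylD_subB (subgP w)))
  end.

Lemma tperm_pairE (x y : 'I_n * bool) k b :
  tperm x y (k, b) =
  if (k == x.1) && (b == x.2) then y else
  if (k == y.1) && (b == y.2) then x else (k, b).
Proof.
by rewrite permE /=; case: x y => [xi xb] [yi yb]; rewrite !xpair_eqE.
Qed.

Lemma spermE i j k b : sperm i j (k, b) = (tperm i j k, b).
Proof.
rewrite permM tperm_pairE; case: (tpermP i j k) => [->|->|/eqP ki /eqP kj].
- by case: b; rewrite /= ?andbF ?andbT ?eqxx tperm_pairE /= ?andbF ?eqxx.
- case: b; rewrite /= ?andbF ?andbT ?eqxx; last first.
    by case: eqP => [->|_]; rewrite tperm_pairE /= !andbF.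
  by rewrite tperm_pairE /= ?eqxx !andbT; case: eqP => [->|].
- rewrite (negbTE ki) (negbTE kj) /= tperm_pairE.
  by rewrite (negbTE ki) (negbTE kj).
Qed.

Lemma sbarpermE i j k b : i != j ->
  sbarperm i j (k, b) = (tperm i j k, b (+) ((k == i) || (k == j))).
Proof.
move=> ij; have ji : (j == i) = false by rewrite eq_sym (negbTE ij).
rewrite permM tperm_pairE; case: (tpermP i j k) => [->|->|/eqP ki /eqP kj].
- by case: b; rewrite /= ?eqxx ?(negbTE ij) ?andbF /= tperm_pairE /=
    ?eqxx ?ji ?(negbTE ij) ?andbF.
- by case: b; rewrite /= ?eqxx ?ji ?andbF /= tperm_pairE /=
    ?eqxx ?ji ?(negbTE ij) ?andbF.
- rewrite (negbTE ki) (negbTE kj) /= tperm_pairE.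
  by rewrite (negbTE ki) (negbTE kj) addbF.
Qed.

Lemma taupermE i k b : tauperm i (k, b) = (k, b (+) (k == i)).
Proof.
by rewrite tperm_pairE /=; case: eqP => [->|_]; case: b.
Qed.

Lemma sperm_B i j : sperm i j \in weylB.
Proof. by apply/weylBP => -[k b]; rewrite /negx /= !spermE. Qed.

Lemma sbarperm_B i j : sbarperm i j \in weylB.
Proof.
apply/weylBP => -[k b]; rewrite /negx /=.
have [<-|ij] := eqVneq i j; first by rewrite /sbarperm [X in (_ * X)%g]tpermC tperm2 !perm1.
by rewrite !sbarpermE //= addNb.
Qed.

Lemma tauperm_B i : tauperm i \in weylB.
Proof. by apply/weylBP => -[k b]; rewrite /negx /= !taupermE addNb. Qed.

Lemma sperm_D i j : sperm i j \in weylD.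
Proof.
rewrite inE sperm_B odd_sign_change big1 // => k _.
by rewrite /sign_change spermE.
Qed.

Lemma sbarperm_D i j : sbarperm i j \in weylD.
Proof.
have [<-|ij] := eqVneq i j.
  by rewrite /sbarperm [X in (_ * X)%g]tpermC tperm2 group1.
rewrite inE sbarperm_B; suff -> : [set k | sign_change (sbarperm i j) k] = [set i; j].
  by rewrite cards2 ij.
by apply/setP=> k; rewrite !inE /sign_change sbarpermE.
Qed.

End WeylGroups.

Inductive odaha_gen (ty : weyl_type) (n : nat) : Type :=
| Xi of 'I_n
| Eta of 'I_n
| Grp of weyl n ty.
Arguments Xi {ty n}.
Arguments Eta {ty n}.
Arguments Grp {ty n}.

Section OddDaha.
Variables (F : fieldType) (ty : weyl_type) (n : nat) (t u v : F).

Local Notation expr ty := (term F (odaha_gen ty n)).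

Definition reflections (i j : 'I_n) : expr ty :=
  match ty return expr ty with
  | TypeA => TGen (@Grp TypeA n (tperm i j))
  | TypeB => TGen (@Grp TypeB n (Subg (sperm_B i j)))
             + TGen (@Grp TypeB n (Subg (sbarperm_B i j)))
  | TypeD => TGen (@Grp TypeD n (Subg (sperm_D i j)))
             + TGen (@Grp TypeD n (Subg (sbarperm_D i j)))
  end.

Definition sign_term (i : 'I_n) : expr ty :=
  match ty return expr ty with
  | TypeB => TCst v * TGen (@Grp TypeB n (Subg (tauperm_B i)))
  | _ => TCst 0
  end.

Local Notation xi i := (TGen (Xi i) : expr ty).
Local Notation eta i := (TGen (Eta i) : expr ty).
Local Notation grp w := (TGen (Grp w) : expr ty).

(* MathComp composes permutations from left to right: (s * r)%g maps x to    *)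
(* r (s x). The product of W used in C W is the opposite one, for which S_n  *)
(* acts on the left on the indices.                                          *)
Inductive odaha_rel : expr ty -> expr ty -> Prop :=
| rel_grp1 : odaha_rel (grp 1%g) (TCst 1)
| rel_grpM (s r : weyl n ty) : odaha_rel (grp s * grp r) (grp (r * s)%g)
| rel_eta i j : i != j ->
    odaha_rel (eta i * eta j) (TCst (-1) * (eta j * eta i))
| rel_xi i j : i != j ->
    odaha_rel (xi i * xi j) (TCst (-1) * (xi j * xi i))
| rel_grp_xi s j : odaha_rel (grp s * xi j) (xi (forget s j) * grp s)
| rel_grp_eta s j : odaha_rel (grp s * eta j) (eta (forget s j) * grp s)
| rel_eta_xi_neq i j : i != j ->
    odaha_rel (eta i * xi j + xi j * eta i) (TCst u * reflections i j)
| rel_eta_xi_eq i :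
    odaha_rel (eta i * xi i + xi i * eta i)
      (TCst t
       + TCst u * \big[@TAdd F _/TCst 0]_(k < n | k != i) reflections k i
       + sign_term i).

Definition odaha : Type := presented odaha_rel.

HB.instance Definition _ := GRing.PzRing.on odaha.
HB.instance Definition _ := GRing.Lmodule.on odaha.

Lemma odaha_scaleAl a (x y : odaha) : a *: (x * y) = (a *: x) * y.
Proof. exact: (@pscaleAl F _ odaha_rel). Qed.

Lemma odaha_scaleAr a (x y : odaha) : a *: (x * y) = x * (a *: y).
Proof. exact: (@pscaleAr F _ odaha_rel). Qed.

Definition oxi (i : 'I_n) : odaha := pgen odaha_rel (Xi i).
Definition oeta (i : 'I_n) : odaha := pgen odaha_rel (Eta i).
Definition ogrp (w : weyl n ty) : odaha := pgen odaha_rel (Grp w).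

(* The Z/2-grading: homogeneous b x means that x lies in the component of    *)
(* degree b (false for even, true for odd).                                  *)
Inductive homogeneous : bool -> odaha -> Prop :=
| homog_xi i : homogeneous true (oxi i)
| homog_eta i : homogeneous true (oeta i)
| homog_grp w : homogeneous false (ogrp w)
| homog_1 : homogeneous false 1
| homog_0 b : homogeneous b 0
| homog_add b x y :
    homogeneous b x -> homogeneous b y -> homogeneous b (x + y)
| homog_scale b a x : homogeneous b x -> homogeneous b (a *: x)
| homog_mul b c x y :
    homogeneous b x -> homogeneous c y -> homogeneous (b (+) c) (x * y).

Definition even_center (x : odaha) : Prop :=
  homogeneous false x /\ forall y, x * y = y * x.

(* p(g_1^2, ..., g_n^2); used for pairwise anticommuting g_i, whose squares  *)
(* commute, so that the order of the product is irrelevant.                  *)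
Definition eval_squares (g : 'I_n -> odaha) (p : {mpoly F[n]}) : odaha :=
  \sum_(m <- msupp p)
    p@_m *: \prod_(i < n) (g i ^+ 2) ^+ (m i).

Definition weyl_invariant (p : {mpoly F[n]}) : Prop :=
  forall w : weyl n ty, msym (forget w) p = p.

End OddDaha.

Definition module_finite (A : pzRingType) (Z : A -> Prop) : Prop :=
  exists s : seq A, forall x : A,
    exists2 c : 'I_(size s) -> A,
      (forall i, Z (c i)) & x = \sum_(i < size s) c i * s`_i.

(* Main.v *)
From HB Require Import structures.
Require Import Defs.
From mathcomp Require Import all_boot all_order all_algebra all_fingroup.
From mathcomp Require Import reals complex ssrcomplements mpoly.
Import GRing.Theory.
Set Implicit Arguments.
Unset Strict Implicit.
Unset Printing Implicit Defensive.
Local Open Scope ring_scope.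

(** Write y_i for the square of eta_i (the case of the xi_i is symmetric).
    Since eta_i and eta_k anticommute for i <> k, every y_i commutes with every
    eta_k. An element of W permutes the y_i through its image in S_n, so a
    W-invariant polynomial in the y_i commutes with W, and it is even. The point
    is that it commutes with the xi_j. As W maps onto S_n in all three types,
    the polynomial is symmetric.

    From [x^2, w] = x [x, w]_+ - [x, w]_+ x and the bracket relations one gets,
    with r_kj the sum of the reflections that lie over the transposition (k j),
      [y_i, xi_j] = u (eta_i - eta_j) r_ij  for i <> j,
      [y_j, xi_j] = u sum_(k <> j) (eta_j - eta_k) r_kj,
    the scalar t and the sign change in [eta_j, xi_j]_+ contributing nothing as
    they commute with eta_j. The twisted Leibniz rule for divided differences
    then gives, for every polynomial p,
      [p(y), xi_j] = u sum_(k <> j) (eta_j - eta_k) (d_jk p)(y) r_kj,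
    where (X_j - X_k) d_jk p = p - s_jk p (Dunkl_commutation). A symmetric p has
    d_jk p = 0 because polynomials form a domain, so p(y) commutes with xi_j
    (symmetric_eval_comm), and hence with everything (weyl_invariant_central).

    For the finiteness, let Z be the even center. Each X_j is a root of the monic
    polynomial prod_i (T - X_i), whose coefficients are symmetric; therefore
    eta_j and xi_j are integral over Z, of degree 2n (ogen_integral). Reordering
    anticommuting integral elements, the words in the xi_i lie in the Z-span of
    finitely many ordered monomials, and so do the words in the eta_i
    (words_ordered). Finally the algebra is spanned by products of a word in the
    xi_i, a word in the eta_i and an element of W: the set of such sums is stable
    under left multiplication by the generators (triangular_all). As W is finite,
    finitely many products span over Z. *)

(** * Evaluation of polynomials at commuting elements *)

(** Properties of evaluation need only be checked on the variables when they are
    compatible with the algebra operations. *)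
Lemma mpoly_alg_ind (K : comNzRingType) (n : nat) (P : {mpoly K[n]} -> Prop) :
    (forall c, P c%:MP) -> (forall i, P 'X_i) ->
    (forall p q, P p -> P q -> P (p + q)) ->
    (forall p q, P p -> P q -> P (p * q)) ->
  forall p, P p.
Proof.
move=> PC PX PD PM; have P1 : P 1 by rewrite -mpolyC1.
move=> p; elim/mpolyind: p => [|c m p _ _ Pp]; first by rewrite -mpolyC0.
apply: PD => //; rewrite -mul_mpolyC; apply: (PM) => //.
rewrite mpolyXE_id; apply: (big_ind P) => [//||i _]; first exact: (PM).
by elim: (m i) => [|k Pk]; rewrite ?expr0 // exprS; apply: (PM).
Qed.

Lemma msym_var (K : comNzRingType) (n : nat) (s : 'S_n) i :
  msym s ('X_i : {mpoly K[n]}) = 'X_(s i).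
Proof. by rewrite /msym mmapX mmap1U. Qed.

Lemma msym_const (K : comNzRingType) (n : nat) (s : 'S_n) c :
  msym s (c%:MP : {mpoly K[n]}) = c%:MP.
Proof. by rewrite /msym mmapC. Qed.

(** The scalars act through a central morphism phi, rather than through an
    algebra structure on the target, so that the target may be the zero ring. *)
Section Evaluation.
Variables (F : fieldType) (A : pzRingType) (phi : {rmorphism F -> A}).
Hypothesis phiC : forall c x, GRing.comm x (phi c).
Variables (n : nat) (y : 'I_n -> A).
Hypothesis yC : forall i j, GRing.comm (y i) (y j).

Definition monomial_at (m : 'X_{1..n}) : A := \prod_(i < n) y i ^+ m i.
Definition eval_at (p : {mpoly F[n]}) : A :=
  \sum_(m <- msupp p) phi p@_m * monomial_at m.

Lemma eval_atE k p : (msize p <= k)%N ->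
  eval_at p = \sum_(m : 'X_{1..n < k}) phi p@_m * monomial_at m.
Proof.
move=> le_pk; rewrite /eval_at.
rewrite (big_mksub ('X_{1..n < k} : subFinType _)) ?msupp_uniq //=; last first.
  by move=> m /msize_mdeg_lt /leq_trans; apply.
by rewrite big_rmcond //= => m /memN_msupp_eq0 ->; rewrite rmorph0 mul0r.
Qed.

Lemma eval_at_is_additive : zmod_morphism eval_at.
Proof.
move=> p q; pose k := maxn (msize (p - q)) (maxn (msize p) (msize q)).
rewrite !(@eval_atE k) ?leq_max ?leqnn ?orbT // -sumrB; apply: eq_bigr => m _.
by rewrite mcoeffB rmorphB mulrBl.
Qed.

HB.instance Definition _ :=
  GRing.isZmodMorphism.Build {mpoly F[n]} A eval_at eval_at_is_additive.

Lemma monomial_atM m1 m2 :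
  monomial_at (m1 + m2) = monomial_at m1 * monomial_at m2.
Proof.
rewrite /monomial_at -prodrM_comm => [|i j _ _].
  by apply: eq_bigr => i _; rewrite mnmDE exprD.
by apply/commrX/commr_sym/commrX.
Qed.

Lemma eval_atZX c m : eval_at (c *: 'X_[m]) = phi c * monomial_at m.
Proof.
have [->|c0] := eqVneq c 0; first by rewrite scale0r raddf0 rmorph0 mul0r.
rewrite /eval_at (perm_big _ (msuppZ _ c0)) msuppX big_seq1.
by rewrite mcoeffZ mcoeffX eqxx mulr1.
Qed.

Lemma eval_atM p q : eval_at (p * q) = eval_at p * eval_at q.
Proof.
elim/mpolyind: p => [|c m p _ _ IHp]; first by rewrite mul0r raddf0 mul0r.
rewrite mulrDl !raddfD /= mulrDl IHp; congr (_ + _).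
elim/mpolyind: q {IHp} => [|d m' q _ _ IHq];
  first by rewrite mulr0 raddf0 mulr0.
rewrite mulrDr !raddfD /= mulrDr IHq; congr (_ + _).
rewrite -scalerAl -scalerAr scalerA -mpolyXD !eval_atZX rmorphM monomial_atM.
by rewrite -!mulrA; congr (_ * _); rewrite !mulrA phiC.
Qed.

Lemma eval_atX i : eval_at 'X_i = y i.
Proof.
rewrite -['X_i]scale1r eval_atZX rmorph1 mul1r /monomial_at.
rewrite (big_only1 i) ?mnm1E ?eqxx // => j ji _.
by rewrite mnm1E eq_sym (negbTE ji).
Qed.

Lemma eval_atC c : eval_at c%:MP = phi c.
Proof.
rewrite -[c%:MP]mulr1 mul_mpolyC -mpolyX0 eval_atZX /monomial_at.
by rewrite big1 ?mulr1 // => i _; rewrite mnm0E.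
Qed.

Lemma eval_at1 : eval_at 1 = 1.
Proof. by rewrite -mpolyC1 eval_atC rmorph1. Qed.

End Evaluation.

(** * Symmetric polynomials in the squares of anticommuting elements *)

Section EvaluationSymmetry.
Variables (F : fieldType) (A : pzRingType) (phi : {rmorphism F -> A}).
Hypothesis phiC : forall c x, GRing.comm x (phi c).
Variables (n : nat) (y : 'I_n -> A).
Hypothesis yC : forall i j, GRing.comm (y i) (y j).
Local Notation ev := (eval_at phi y).

Lemma eval_at_intertwine (w : A) (s : 'S_n) (p : {mpoly F[n]}) :
    (forall i, w * y i = y (s i) * w) -> w * ev p = ev (msym s p) * w.
Proof.
move=> wy; elim/mpoly_alg_ind: p => [c|i|p q IHp IHq|p q IHp IHq].
- by rewrite msym_const eval_atC phiC.
- by rewrite msym_var !eval_atX.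
- by rewrite !raddfD /= mulrDl mulrDr IHp IHq.
- by rewrite msymM !eval_atM // mulrA IHp -!mulrA IHq.
Qed.

Lemma comm_eval_at (w : A) (p : {mpoly F[n]}) :
  (forall i, GRing.comm w (y i)) -> GRing.comm w (ev p).
Proof.
move=> wy; rewrite /GRing.comm -[p in RHS]msym1m.
by apply: eval_at_intertwine => i; rewrite perm1; apply: wy.
Qed.

End EvaluationSymmetry.

(** The relations are abstracted so that they apply both to a = eta, b = xi and
    to a = xi, b = eta: r i j stands for the reflections over the transposition
    of i and j, c for u, and z i for the part of the bracket of a i and b i that
    commutes with a i. *)
Section DunklCommutation.
Variables (F : fieldType) (A : pzRingType) (phi : {rmorphism F -> A}).
Hypothesis phiC : forall c x, GRing.comm x (phi c).
Variables (n : nat) (a b z : 'I_n -> A) (r : 'I_n -> 'I_n -> A) (c : A).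
Hypothesis aN : forall i j, i != j -> a i * a j = - (a j * a i).
Hypothesis cC : forall x, GRing.comm x c.
Hypothesis ra : forall i j k, r i j * a k = a (tperm i j k) * r i j.
Hypothesis az : forall i, GRing.comm (a i) (z i).
Hypothesis ab_neq : forall i j, i != j -> a i * b j + b j * a i = c * r i j.
Hypothesis ab_eq : forall i,
  a i * b i + b i * a i = z i + c * \sum_(k | k != i) r k i.

Local Notation ev := (eval_at phi (fun i => a i ^+ 2)).

Lemma sqr_anticomm i k : GRing.comm (a k) (a i ^+ 2).
Proof.
have [->|ki] := eqVneq k i; first by apply: commrX.
by rewrite /GRing.comm expr2 mulrA aN // mulNr -mulrA aN // mulrN opprK mulrA.
Qed.

Lemma sqr_comm i j : GRing.comm (a i ^+ 2) (a j ^+ 2).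
Proof. by apply/commr_sym/commrX/commr_sym/sqr_anticomm. Qed.

(** The commutator with a square is a commutator with the anticommutator; this
    turns the bracket relations into information about the squares. *)
Lemma commutator_sqr x w :
  x ^+ 2 * w - w * x ^+ 2 = x * (x * w + w * x) - (x * w + w * x) * x :> A.
Proof. by rewrite mulrDr mulrDl !mulrA opprD addrA addrK expr2 -!mulrA. Qed.

(** The polynomial g k is the divided difference of p with respect to X_j and
    X_k. Specifying it by a product avoids dividing, and the pairs (p, g) are
    closed under products by the twisted Leibniz rule
    d(pq) = (d p) (s q) + p (d q). *)
Lemma Dunkl_commutation j p : exists2 g : 'I_n -> {mpoly F[n]},
  forall k, k != j -> ('X_j - 'X_k) * g k = p - msym (tperm j k) p
  & ev p * b j = b j * ev p
      + \sum_(k | k != j) c * (a j - a k) * ev (g k) * r k j.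
Proof.
elim/mpoly_alg_ind: p =>
  [d|i|p q [g gE IHp] [h hE IHq]|p q [g gE IHp] [h hE IHq]].
- exists (fun=> 0) => [k _|]; first by rewrite mulr0 msym_const subrr.
  rewrite big1 ?addr0 => [|k _]; first by rewrite eval_atC phiC.
  by rewrite raddf0 mulr0 mul0r.
- rewrite eval_atX //; have [->{i}|ij] := eqVneq i j.
    exists (fun=> 1) => [k _|]; first by rewrite mulr1 msym_var tpermL.
    apply/eqP; rewrite addrC -subr_eq commutator_sqr ab_eq; apply/eqP.
    rewrite mulrDr mulrDl opprD addrACA az subrr add0r.
    rewrite mulrA cC -!mulrA -mulrBr mulr_suml mulr_sumr -sumrB mulr_sumr.
    apply: eq_bigr => k kj.
    by rewrite eval_at1 mulr1 ra tpermR -mulrBl mulrA.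
  (* Only the transposition of i and j moves X_i, and it sends it to X_j. *)
  exists (fun k => if k == i then -1 else 0) => [k kj|].
    rewrite msym_var; have [->|ki] := eqVneq k i.
      by rewrite tpermR mulrN1 opprB.
    by rewrite mulr0 tpermD ?subrr // eq_sym.
  rewrite (bigD1 i) //= eqxx big1 ?addr0 => [|k /andP[_ /negbTE->]]; last first.
    by rewrite raddf0 mulr0 mul0r.
  apply/eqP; rewrite addrC -subr_eq commutator_sqr ab_neq //; apply/eqP.
  rewrite mulrA cC -!mulrA ra tpermL -mulrBr -mulrBl.
  by rewrite raddfN /= eval_at1 mulN1r mulrN -mulNr opprB.
- exists (fun k => g k + h k) => [k kj|].
    by rewrite mulrDr gE // hE // raddfD /= opprD addrACA.
  rewrite raddfD /= mulrDl mulrDr IHp IHq addrACA -big_split /=.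
  congr (_ + _); apply: eq_bigr => k _.
  by rewrite raddfD /= [in RHS](mulrDr (c * _)) mulrDl.
- exists (fun k => g k * msym (tperm j k) q + p * h k) => [k kj|].
    rewrite mulrDr mulrA gE // mulrCA hE // msymM.
    by rewrite mulrBl mulrBr addrC addrA subrK.
  rewrite eval_atM //; last exact: sqr_comm.
  rewrite -mulrA IHq mulrDr mulrA IHp mulrDl -addrA mulr_suml mulr_sumr.
  rewrite -mulrA -big_split; congr (_ + _); apply: eq_bigr => k kj /=.
  have rq : r k j * ev q = ev (msym (tperm j k) q) * r k j.
    apply: eval_at_intertwine => // [|i]; first exact: sqr_comm.
    by rewrite !expr2 mulrA ra -mulrA ra mulrA tpermC.
  have pa : GRing.comm (ev p) (c * (a j - a k)).
    apply: commrM => //; apply: commr_sym; apply: comm_eval_at => // [|i].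
      exact: sqr_comm.
    by apply/commr_sym/commrB; apply/commr_sym/sqr_anticomm.
  rewrite raddfD /= !eval_atM //; try exact: sqr_comm.
  move: (c * _) pa => d pa.
  by rewrite mulrDr mulrDl -[_ * r k j * ev q]mulrA rq !mulrA pa.
Qed.

(** The divided differences of a symmetric polynomial vanish, as X_j - X_k is not
    a zero divisor. *)
Lemma symmetric_eval_comm p j :
  (forall k, msym (tperm j k) p = p) -> GRing.comm (ev p) (b j).
Proof.
move=> p_sym; have [g gE] := Dunkl_commutation j p; rewrite /GRing.comm => ->.
rewrite big1 ?addr0 // => k kj; have /eqP := gE k kj.
rewrite p_sym subrr mulf_eq0 => /orP[|/eqP->].
  rewrite subr_eq0 => /eqP/(congr1 (mcoeff U_(j)))/eqP.
  by rewrite !mcoeffX eqxx eq_mnm1 (negbTE kj) oner_eq0.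
by rewrite raddf0 mulr0 mul0r.
Qed.

End DunklCommutation.

(** The relation says that X_j is a root of prod_i (T - X_i), whose coefficients
    are symmetric since permuting the variables permutes the factors. *)
Lemma symmetric_monic_relation (K : idomainType) (n : nat) :
  exists2 e : 'I_n -> {mpoly K[n]}, forall k s, msym s (e k) = e k
    & forall j, 'X_j ^+ n = \sum_(k < n) e k * 'X_j ^+ k.
Proof.
pose q : {poly {mpoly K[n]}} := \prod_(i < n) ('X - ('X_i)%:P).
have q_sym s k : msym s q`_k = q`_k.
  rewrite -coef_map; congr ((polyseq _)`_k).
  rewrite rmorph_prod /q [in RHS](reindex_inj (@perm_inj _ s)) /=.
  by apply: eq_bigr => i _; rewrite map_polyXsubC /= msym_var.
have sz_q : size q = n.+1.
  by rewrite /q size_prod_XsubC /index_enum -enumT size_enum_ord.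
have q_monic : q`_n = 1.
  have /eqP <- : q \is monic by apply: monic_prod_XsubC.
  by rewrite lead_coefE sz_q.
exists (fun k => - q`_k) => [k s|j]; first by rewrite raddfN /= q_sym.
have: q.['X_j] = 0.
  apply/eqP; rewrite /q horner_prod; apply/prodf_eq0; exists j => //.
  by rewrite hornerXsubC subrr.
rewrite horner_coef sz_q big_ord_recr /= q_monic mul1r => /eqP.
rewrite addrC addr_eq0 => /eqP ->; rewrite -sumrN.
by apply: eq_bigr => k _; rewrite mulNr.
Qed.

(** * Modules over a central subring *)

Section SpansOverCentralSubring.
Variables (A : pzRingType) (Z : A -> Prop).
Hypothesis Z0 : Z 0.
Hypothesis Z1 : Z 1.
Hypothesis ZN1 : Z (-1).
Hypothesis ZD : forall x y, Z x -> Z y -> Z (x + y).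
Hypothesis ZM : forall x y, Z x -> Z y -> Z (x * y).
Hypothesis Zcentral : forall x y, Z x -> x * y = y * x.

Inductive zspan (s : seq A) : A -> Prop :=
| zspan0 : zspan s 0
| zspanD x y : zspan s x -> zspan s y -> zspan s (x + y)
| zspanG c x : Z c -> x \in s -> zspan s (c * x).

Lemma zspan_mem s x : x \in s -> zspan s x.
Proof. by rewrite -[x in zspan s x]mul1r => sx; apply: zspanG. Qed.

Lemma zspanZ s c x : Z c -> zspan s x -> zspan s (c * x).
Proof.
move=> Zc; elim=> [|u v _ su _ sv|d u Zd su];
  first by rewrite mulr0; apply: zspan0.
  by rewrite mulrDr; apply: zspanD.
by rewrite mulrA; apply: zspanG => //; apply: ZM.
Qed.

(** Centrality of Z lets the coefficients move out of a product. *)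
Lemma zspanM s t x y :
  zspan s x -> zspan t y -> zspan [seq u * v | u <- s, v <- t] (x * y).
Proof.
move=> sx ty; elim: sx => [|u v _ su _ sv|c u Zc su];
  first by rewrite mul0r; apply: zspan0.
  by rewrite mulrDl; apply: zspanD.
elim: ty => [|v w _ tv _ tw|d v Zd tv]; first by rewrite mulr0; apply: zspan0.
  by rewrite mulrDr; apply: zspanD.
rewrite mulrA -[c * u * d]mulrA -[u * d](Zcentral _ Zd) mulrA -mulrA.
by apply: zspanG; [apply: ZM | apply: allpairs_f].
Qed.

Lemma zspan_coef s x : zspan s x ->
  exists2 c : 'I_(size s) -> A,
    forall i, Z (c i) & x = \sum_(i < size s) c i * s`_i.
Proof.
elim=> [|u v _ [c Zc ->] _ [d Zd ->]|c u Zc su].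
- by exists (fun=> 0) => //; rewrite big1 // => i _; rewrite mul0r.
- exists (fun i => c i + d i) => [i|]; first exact: ZD.
  by rewrite -big_split; apply: eq_bigr => i _; rewrite mulrDl.
have lt_u : (index u s < size s)%N by rewrite index_mem.
exists (fun i => if i == Ordinal lt_u then c else 0) => [i|];
  first by case: ifP.
rewrite (bigD1 (Ordinal lt_u)) //= eqxx nth_index // big1 ?addr0 //.
by move=> i /negbTE ->; rewrite mul0r.
Qed.

(** Integral, pairwise anticommuting elements generate a finite Z-module. *)
Section Words.
Variables (I : finType) (a : I -> A).

(** The Z-subalgebra generated by the a i, presented by left multiplications so
    that an induction peels off one letter at a time. *)
Inductive words : A -> Prop :=
| words1 : words 1
| wordsD x y : words x -> words y -> words (x + y)
| wordsZ c x : Z c -> words x -> words (c * x)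
| wordsM i x : words x -> words (a i * x).

Hypothesis aN : forall i j, i != j -> a i * a j = - (a j * a i).
Variable (N : I -> nat).
Hypothesis N_gt0 : forall i, (0 < N i)%N.
Let powers i := [seq a i ^+ k | k <- iota 0 (N i)].
Hypothesis a_int : forall i, zspan (powers i) (a i ^+ N i).

Definition ordered_monomials (r : seq I) : seq A :=
  foldr (fun i t => [seq x * y | x <- powers i, y <- t]) [:: 1] r.

Lemma ordered_monomials1 r : zspan (ordered_monomials r) 1.
Proof.
elim: r => [|i r IH] /=; first by apply: zspan_mem; rewrite inE.
rewrite -[1]mul1r; apply: zspanM IH; apply: zspan_mem.
by apply/mapP; exists 0%N => //; rewrite mem_iota N_gt0.
Qed.

Lemma powers_stable i x : zspan (powers i) x -> zspan (powers i) (a i * x).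
Proof.
elim=> [|u v _ su _ sv|c w Zc /mapP[k lt_k ->{w}]];
  first by rewrite mulr0; apply: zspan0.
  by rewrite mulrDr; apply: zspanD.
move: lt_k; rewrite mem_iota => /= lt_k.
rewrite mulrA -(Zcentral _ Zc) -mulrA -exprS; apply: zspanZ => //.
have:= lt_k; rewrite leq_eqVlt => /predU1P[->//|lt_k1].
by apply: zspan_mem; apply/mapP; exists k.+1; rewrite // mem_iota.
Qed.

Lemma anticomm_pow i j k : i != j ->
  a i * a j ^+ k = (-1) ^+ k * a j ^+ k * a i.
Proof.
move=> ij; elim: k => [|k IH]; first by rewrite !expr0 mulr1 !mul1r.
rewrite exprS mulrA aN // mulNr -mulrA IH [in RHS]exprS mulN1r !mulNr !mulrA.
by congr (- (_ * _ * _)); apply/commrX/commrN1.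
Qed.

(** The factor a i moves to the right, at the cost of a sign for each factor a j
    it crosses, until it meets the powers of a i and is absorbed by
    integrality. *)
Lemma ordered_monomials_stable r i x : i \in r ->
  zspan (ordered_monomials r) x -> zspan (ordered_monomials r) (a i * x).
Proof.
elim: r x => // j r IH x; rewrite inE => ijr.
elim=> [|u v _ su _ sv|c w Zc /allpairsP[[p q] /= [pj qr ->{w}]]].
- by rewrite mulr0; apply: zspan0.
- by rewrite mulrDr; apply: zspanD.
rewrite mulrA -(Zcentral _ Zc) -mulrA; apply: zspanZ => //.
have [eq_ij|ij] := eqVneq i j.
  rewrite mulrA; apply: zspanM; last exact: zspan_mem.
  by rewrite eq_ij; apply: powers_stable; apply: zspan_mem.
have /mapP[k lt_k ->] := pj.
rewrite mulrA anticomm_pow // -!mulrA; apply: zspanZ.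
  by elim: k {lt_k} => [|k IHk]; rewrite ?exprS //; apply: ZM.
apply: zspanM; first by apply: zspan_mem; apply: map_f.
by apply: IH; [move: ijr; rewrite (negbTE ij) | apply: zspan_mem].
Qed.

Lemma words_ordered x : words x -> zspan (ordered_monomials (enum I)) x.
Proof.
elim=> [|u v _ su _ sv|c u Zc _ su|i u _ su].
- exact: ordered_monomials1.
- exact: zspanD.
- exact: zspanZ.
- by apply: ordered_monomials_stable; rewrite ?mem_enum.
Qed.

End Words.
End SpansOverCentralSubring.

(** * Reflections in the three Weyl groups *)

Section Reflections.
Variables (F : fieldType) (ty : weyl_type) (n : nat).

Lemma sbarperm_id (i : 'I_n) : sbarperm i i = 1%g.
Proof. by rewrite /sbarperm [X in (_ * X)%g]tpermC tperm2. Qed.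

Lemma sbarperm_fst (i j k : 'I_n) : (sbarperm i j (k, false)).1 = tperm i j k.
Proof.
have [<-|ij] := eqVneq i j; first by rewrite sbarperm_id tperm1 !perm1.
by rewrite sbarpermE.
Qed.

Lemma spermC (i j : 'I_n) : sperm i j = sperm j i.
Proof. by apply/permP=> -[k b]; rewrite !spermE tpermC. Qed.

Lemma sbarpermC (i j : 'I_n) : sbarperm i j = sbarperm j i.
Proof.
have [->//|ij] := eqVneq i j; apply/permP=> -[k b].
by rewrite !sbarpermE // 1?eq_sym // tpermC orbC.
Qed.

Lemma reflectionsC (i j : 'I_n) : reflections F ty i j = reflections F ty j i.
Proof.
rewrite /reflections; case: ty; rewrite 1?tpermC //.
  have -> : Subg (sperm_B i j) = Subg (sperm_B j i) by apply/val_inj/spermC.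
  suff -> : Subg (sbarperm_B i j) = Subg (sbarperm_B j i) by [].
  exact/val_inj/sbarpermC.
have -> : Subg (sperm_D i j) = Subg (sperm_D j i) by apply/val_inj/spermC.
suff -> : Subg (sbarperm_D i j) = Subg (sbarperm_D j i) by [].
exact/val_inj/sbarpermC.
Qed.

(** A description of the reflections that no longer depends on the type: one or
    two group elements over the same transposition. It shows too that every
    transposition is in the image of W. *)
Lemma reflectionsP (i j : 'I_n) : exists w : weyl n ty, forget w = tperm i j /\
  (reflections F ty i j = TGen (Grp w) \/
   exists w' : weyl n ty, forget w' = tperm i j /\
     reflections F ty i j = TAdd (TGen (Grp w)) (TGen (Grp w'))).
Proof.
rewrite /reflections; case: ty.
- by exists (tperm i j); split=> //; left.
- exists (Subg (sperm_B i j)); split.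
    by apply/permP=> k; rewrite permE /= spermE.
  right; exists (Subg (sbarperm_B i j)); split=> //.
  by apply/permP=> k; rewrite permE /= sbarperm_fst.
- exists (Subg (sperm_D i j)); split.
    by apply/permP=> k; rewrite permE /= spermE.
  right; exists (Subg (sbarperm_D i j)); split=> //.
  by apply/permP=> k; rewrite permE /= sbarperm_fst.
Qed.

Lemma sign_termP (v : F) (i : 'I_n) : sign_term ty v i = TCst 0 \/
  exists2 w : weyl n ty, forget w = 1%g
    & sign_term ty v i = TMul (TCst v) (TGen (Grp w)).
Proof.
rewrite /sign_term; case: ty; [by left | right | by left].
exists (Subg (tauperm_B i)) => //.
by apply/permP=> k; rewrite permE /= taupermE perm1.
Qed.

End Reflections.

(** * Relations in the odd double affine Hecke algebra *)

Section OddDahaStructure.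
Variables (F : fieldType) (ty : weyl_type) (n : nat) (t u v : F).
Local Notation H := (@odaha F ty n t u v).
Local Notation rel := (@odaha_rel F ty n t u v).
Local Notation expr := (term F (odaha_gen ty n)).

Definition oclass (e : expr) : H := \pi_(presented rel)%qT e.

Lemma oclassD e f : oclass (TAdd e f) = oclass e + oclass f.
Proof. exact/esym/(@padd_pi _ _ rel). Qed.

Lemma oclassM e f : oclass (TMul e f) = oclass e * oclass f.
Proof. exact/esym/(@pmul_pi _ _ rel). Qed.

Lemma oclass_rel e f : rel e f -> oclass e = oclass f.
Proof. by move=> ef; apply/(@cong_piP _ _ rel)/cong_rel. Qed.

Definition oscalar (c : F) : H := pcst rel c.

Lemma oscalar_is_zmod_morphism : zmod_morphism oscalar.
Proof.
have oscalarD c d : oscalar (c + d) = oscalar c + oscalar d by apply: pcstD.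
by move=> c d; rewrite -[in RHS](subrK d c) [in RHS]oscalarD addrK.
Qed.

Lemma oscalar_is_monoid_morphism : monoid_morphism oscalar.
Proof. by split=> // c d; apply: pcstM. Qed.

HB.instance Definition _ :=
  GRing.isZmodMorphism.Build F H oscalar oscalar_is_zmod_morphism.
HB.instance Definition _ :=
  GRing.isMonoidMorphism.Build F H oscalar oscalar_is_monoid_morphism.

Lemma comm_oscalar c (x : H) : GRing.comm x (oscalar c).
Proof. exact/esym/(@pcstC _ _ rel). Qed.

Lemma oclass_cst c : oclass (TCst c) = oscalar c. Proof. by []. Qed.

(** Both families of odd generators, so that statements symmetric under the
    exchange of xi and eta are proved once: true stands for eta, false for
    xi. *)
Definition ogen (b : bool) : 'I_n -> H :=
  if b then @oeta F ty n t u v else @oxi F ty n t u v.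
Local Notation grp := (@ogrp F ty n t u v).

Lemma odaha_ind (P : H -> Prop) :
    (forall c, P (oscalar c)) -> (forall b i, P (ogen b i)) ->
    (forall w, P (grp w)) ->
    (forall x y, P x -> P y -> P (x + y)) ->
    (forall x y, P x -> P y -> P (x * y)) ->
  forall x, P x.
Proof.
move=> Pc Pg Pw PD PM; elim/quotW; elim=> [[i|i|w]|c|e IHe f IHf|e IHe f IHf].
- exact: (Pg false).
- exact: (Pg true).
- exact: Pw.
- exact: Pc.
- by have := PD _ _ IHe IHf; rewrite -oclassD.
- by have := PM _ _ IHe IHf; rewrite -oclassM.
Qed.

Lemma ogrpM s r : grp s * grp r = grp (r * s)%g.
Proof. by have := oclass_rel (rel_grpM t u v s r); rewrite oclassM. Qed.

Lemma ogrp1 : grp 1%g = 1.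
Proof. exact: (oclass_rel (rel_grp1 _ _ t u v)). Qed.

Lemma ogrp_gen w b i : grp w * ogen b i = ogen b (forget w i) * grp w.
Proof.
case: b.
  by have := oclass_rel (rel_grp_eta t u v w i); rewrite !oclassM.
by have := oclass_rel (rel_grp_xi t u v w i); rewrite !oclassM.
Qed.

Lemma ogen_anticomm b i j :
  i != j -> ogen b i * ogen b j = - (ogen b j * ogen b i).
Proof.
move=> ij; rewrite -[in RHS]mulN1r -(rmorphN1 oscalar).
case: b.
  by have := oclass_rel (rel_eta ty t u v ij); rewrite !oclassM.
by have := oclass_rel (rel_xi ty t u v ij); rewrite !oclassM.
Qed.

Definition orefl (i j : 'I_n) : H := oclass (reflections F ty i j).
Definition osign (i : 'I_n) : H := oclass (sign_term ty v i).

Lemma oreflC i j : orefl i j = orefl j i.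
Proof. by rewrite /orefl reflectionsC. Qed.

Lemma orefl_gen i j b k :
  orefl i j * ogen b k = ogen b (tperm i j k) * orefl i j.
Proof.
rewrite /orefl; have [w [wE [->|[w' [w'E ->]]]]] := reflectionsP F ty i j.
  by rewrite ogrp_gen wE.
by rewrite oclassD mulrDl mulrDr !ogrp_gen wE w'E.
Qed.

Lemma osign_gen i b k : GRing.comm (ogen b k) (osign i).
Proof.
apply: commr_sym; rewrite /osign /GRing.comm.
have [->|[w wE ->]] := sign_termP ty v i.
  by rewrite oclass_cst rmorph0 mul0r mulr0.
by rewrite oclassM oclass_cst -mulrA ogrp_gen wE perm1 !mulrA comm_oscalar.
Qed.

(** The brackets are symmetric under the exchange of xi and eta because the
    reflections r_ij are symmetric in i and j. *)
Lemma ogen_bracket_neq b i j : i != j ->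
  ogen b i * ogen (~~ b) j + ogen (~~ b) j * ogen b i = oscalar u * orefl i j.
Proof.
have eta_xi k l : k != l ->
    ogen true k * ogen false l + ogen false l * ogen true k
      = oscalar u * orefl k l.
  move=> kl; have := oclass_rel (rel_eta_xi_neq ty t u v kl).
  by rewrite oclassD !oclassM.
by case: b => ij /=; [apply: eta_xi | rewrite addrC oreflC eta_xi // eq_sym].
Qed.

Lemma ogen_bracket_eq b i :
  ogen b i * ogen (~~ b) i + ogen (~~ b) i * ogen b i
    = oscalar t + osign i + oscalar u * \sum_(k | k != i) orefl k i.
Proof.
suff eta_xi : ogen true i * ogen false i + ogen false i * ogen true i
    = oscalar t + osign i + oscalar u * \sum_(k | k != i) orefl k i.
  by case: b => //=; rewrite addrC.
have := oclass_rel (rel_eta_xi_eq ty t u v i); rewrite !oclassD !oclassM => ->.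
rewrite addrAC; congr (_ + _ * _).
by rewrite (big_morph oclass (id1 := 0) oclassD (erefl _)).
Qed.

(** * Invariants lie in the even center *)

Lemma weyl_invariant_tperm p j k :
  @weyl_invariant F ty n p -> msym (tperm j k) p = p.
Proof. by have [w [<- _]] := reflectionsP F ty j k => /(_ w). Qed.

Lemma eval_squaresE b p :
  eval_squares (ogen b) p = eval_at oscalar (fun i => ogen b i ^+ 2) p.
Proof. by []. Qed.

(** Commutation is checked on generators: squares commute with their own family,
    the other family is the case of divided differences, and W acts by permuting
    the variables. *)
Lemma weyl_invariant_central b p : @weyl_invariant F ty n p ->
  forall x, eval_squares (ogen b) p * x = x * eval_squares (ogen b) p.
Proof.
move=> p_inv; rewrite eval_squaresE; set e := eval_at _ _ _ => x.
have sqC i k : GRing.comm (ogen b k) (ogen b i ^+ 2).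
  exact: sqr_anticomm (ogen_anticomm b) i k.
have sqCC i k : GRing.comm (ogen b i ^+ 2) (ogen b k ^+ 2).
  exact: sqr_comm (ogen_anticomm b) i k.
have eC k : GRing.comm e (ogen b k).
  apply/commr_sym/comm_eval_at => //; exact: comm_oscalar.
have eNC k : GRing.comm e (ogen (~~ b) k).
  apply: (symmetric_eval_comm (z := fun i => oscalar t + osign i) (r := orefl)
    (c := oscalar u) comm_oscalar (ogen_anticomm b)).
  - by move=> y; apply: comm_oscalar.
  - by move=> i j l; apply: orefl_gen.
  - by move=> i; apply: commrD; [apply: comm_oscalar | apply: osign_gen].
  - exact: ogen_bracket_neq.
  - exact: ogen_bracket_eq.
  - by move=> l; apply: weyl_invariant_tperm.
elim/odaha_ind: x => [c|b' i|w|x y IHx IHy|x y IHx IHy].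
- exact: comm_oscalar.
- have [->|] := eqVneq b' b; first exact: eC.
  by case: (b) b' eNC => -[] // eNC _; apply: eNC.
- rewrite [RHS](eval_at_intertwine comm_oscalar sqCC (s := forget w)).
  + by rewrite p_inv.
  + by move=> i; rewrite !expr2 mulrA ogrp_gen -mulrA ogrp_gen mulrA.
- by rewrite mulrDl mulrDr IHx IHy.
- by rewrite mulrA IHx -mulrA IHy mulrA.
Qed.

Local Notation Z := (@even_center F ty n t u v).

Lemma homogeneous_exp (x : H) k :
  homogeneous false x -> homogeneous false (x ^+ k).
Proof.
move=> x0; elim: k => [|k IH]; first exact: homog_1.
by rewrite exprS; apply: (homog_mul x0 IH).
Qed.

Lemma eval_squares_even_center b p :
  @weyl_invariant F ty n p -> Z (eval_squares (ogen b) p).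
Proof.
move=> p_inv; split; last exact: weyl_invariant_central.
rewrite /eval_squares; apply: big_ind => [||m _]; first exact: homog_0.
  by move=> x y; apply: homog_add.
apply: homog_scale; apply: big_ind => [||i _]; first exact: homog_1.
  by move=> x y x0 y0; apply: (homog_mul x0 y0).
have g1 : homogeneous true (ogen b i) by case: (b); constructor.
by apply: homogeneous_exp; apply: (homog_mul g1 g1).
Qed.

Lemma even_center_scalar c : Z (oscalar c).
Proof.
split=> [|x]; last by rewrite comm_oscalar.
rewrite -[oscalar c]mulr1; apply: (@homog_scale _ _ _ t u v _ c 1).
exact: homog_1.
Qed.

Lemma even_center0 : Z 0.
Proof. by rewrite -(rmorph0 oscalar); apply: even_center_scalar. Qed.

Lemma even_center1 : Z 1. Proof. exact: even_center_scalar. Qed.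

Lemma even_centerN1 : Z (-1).
Proof. by rewrite -(rmorphN1 oscalar); apply: even_center_scalar. Qed.

Lemma even_centerD x y : Z x -> Z y -> Z (x + y).
Proof.
move=> [x0 xC] [y0 yC]; split=> [|w]; first exact: homog_add.
by rewrite mulrDl mulrDr xC yC.
Qed.

Lemma even_centerM x y : Z x -> Z y -> Z (x * y).
Proof.
move=> [x0 xC] [y0 yC]; split=> [|w]; first exact: (homog_mul x0 y0).
by rewrite -mulrA yC mulrA xC mulrA.
Qed.

Lemma even_center_central x y : Z x -> x * y = y * x.
Proof. by case=> _; apply. Qed.

(** * Finiteness over the even center *)

(** The symmetric monic relation of degree n for X_i, evaluated at the
    squares, only involves even powers of the generator. *)
Lemma ogen_integral b i :
  zspan Z [seq ogen b i ^+ k | k <- iota 0 (2 * n)] (ogen b i ^+ (2 * n)).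
Proof.
have [e e_sym eE] := symmetric_monic_relation F n.
have sqCC j k : GRing.comm (ogen b j ^+ 2) (ogen b k ^+ 2).
  exact: sqr_comm (ogen_anticomm b) j k.
pose ev := eval_at oscalar (fun i => ogen b i ^+ 2).
have evX k : ev ('X_i ^+ k) = ogen b i ^+ (2 * k).
  elim: k => [|k IH]; first by rewrite muln0 !expr0 /ev eval_at1.
  rewrite exprS /ev (eval_atM comm_oscalar) // eval_atX // -/ev IH.
  by rewrite mulnS exprD.
rewrite -evX eE /ev raddf_sum /=.
apply: big_ind => [||k _]; [exact: zspan0 | exact: zspanD |].
rewrite (eval_atM comm_oscalar) // -/ev evX; apply: zspanG.
  rewrite /ev -eval_squaresE; apply: eval_squares_even_center => w.
  exact: e_sym.
by apply: map_f; rewrite mem_iota /= ltn_pmul2l.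
Qed.

Local Notation gen_words b := (words Z (ogen b)).

(** The span of the products X Y W, where X and Y are the words in the xi and in
    the eta: the spanning half of a Poincare-Birkhoff-Witt theorem asserts that
    it is everything. *)
Inductive triangular : H -> Prop :=
| triangular0 : triangular 0
| triangularD x y : triangular x -> triangular y -> triangular (x + y)
| triangularM x y w : gen_words false x -> gen_words true y ->
    triangular (x * y * grp w).

(** This is what moves the elements of W to the right end of a product. *)
Lemma grp_words b w x : gen_words b x ->
  exists2 x', gen_words b x' & grp w * x = x' * grp w.
Proof.
elim=> [|y z _ [y' wy yE] _ [z' wz zE]|c y Zc _ [y' wy yE]|i y _ [y' wy yE]].
- by exists 1; [apply: words1 | rewrite mulr1 mul1r].
- by exists (y' + z'); [apply: wordsD | rewrite mulrDl mulrDr yE zE].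
- exists (c * y'); first exact: wordsZ.
  by rewrite mulrA -(even_center_central _ Zc) -!mulrA yE.
- exists (ogen b (forget w i) * y'); first exact: wordsM.
  by rewrite mulrA ogrp_gen -!mulrA yE.
Qed.

Lemma triangularZ c x : Z c -> triangular x -> triangular (c * x).
Proof.
move=> Zc; elim=> [|y z _ IHy _ IHz|y z w wy wz];
  first by rewrite mulr0; apply: triangular0.
  by rewrite mulrDr; apply: triangularD.
by rewrite !mulrA; apply: triangularM => //; apply: wordsZ.
Qed.

Lemma triangular_xi i x : triangular x -> triangular (ogen false i * x).
Proof.
elim=> [|y z _ IHy _ IHz|y z w wy wz];
  first by rewrite mulr0; apply: triangular0.
  by rewrite mulrDr; apply: triangularD.
by rewrite !mulrA; apply: triangularM => //; apply: wordsM.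
Qed.

Lemma triangular_grp w x : triangular x -> triangular (grp w * x).
Proof.
elim=> [|y z _ IHy _ IHz|y z s wy wz];
  first by rewrite mulr0; apply: triangular0.
  by rewrite mulrDr; apply: triangularD.
have [y' wy' yE] := grp_words w wy; have [z' wz' zE] := grp_words w wz.
rewrite !mulrA yE -[y' * grp w * z]mulrA zE !mulrA -(mulrA (y' * z')) ogrpM.
exact: triangularM.
Qed.

Lemma triangular_orefl i j x : triangular x -> triangular (orefl i j * x).
Proof.
rewrite /orefl; have [w [_ [->|[w' [_ ->]]]]] := reflectionsP F ty i j => tx.
  exact: triangular_grp.
by rewrite oclassD mulrDl; apply: triangularD; apply: triangular_grp.
Qed.

Lemma triangular_osign i x : triangular x -> triangular (osign i * x).
Proof.
move=> tx; rewrite /osign; have [->|[w _ ->]] := sign_termP ty v i.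
  by rewrite oclass_cst rmorph0 mul0r; apply: triangular0.
rewrite oclassM -mulrA; apply: triangularZ; first exact: even_center_scalar.
exact: triangular_grp.
Qed.

Lemma triangular_bracket i j x : triangular x ->
  triangular ((ogen true i * ogen false j + ogen false j * ogen true i) * x).
Proof.
move=> tx; have scal c y : triangular y -> triangular (oscalar c * y).
  by apply: triangularZ; apply: even_center_scalar.
have [->|ij] := eqVneq i j; last first.
  by rewrite (ogen_bracket_neq true ij) -mulrA; apply/scal/triangular_orefl.
rewrite (ogen_bracket_eq true) !mulrDl -mulrA mulr_suml.
apply: triangularD.
  by apply: triangularD; [apply: scal | apply: triangular_osign].
apply: scal; apply: big_ind => [||k _]; first exact: triangular0.
  exact: triangularD.
exact: triangular_orefl.
Qed.

(** Induction on the word in the xi: moving eta_i past xi_k produces the bracket,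
    a combination of elements of W, applied to a shorter product, and a term in
    which eta_i has advanced by one letter. *)
Lemma triangular_eta i x : triangular x -> triangular (ogen true i * x).
Proof.
elim=> [|y z _ IHy _ IHz|y z w wy wz];
  first by rewrite mulr0; apply: triangular0.
  by rewrite mulrDr; apply: triangularD.
elim: wy => [|y1 y2 _ IH1 _ IH2|c y' Zc _ IH|k y' wy' IH].
- rewrite mul1r mulrA -[_ * z]mul1r.
  by apply: triangularM; [apply: words1 | apply: wordsM].
- by rewrite !mulrDl mulrDr; apply: triangularD.
- rewrite -!mulrA [ogen true i * (c * _)]mulrA.
  rewrite -(even_center_central _ Zc) -mulrA.
  by apply: triangularZ => //; move: IH; rewrite -!mulrA.
have -> : ogen true i * (ogen false k * y' * z * grp w)
    = (ogen true i * ogen false k + ogen false k * ogen true i)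
        * (y' * z * grp w)
      + (-1) * (ogen false k * (ogen true i * (y' * z * grp w))).
  by rewrite mulrDl mulN1r !mulrA addrK.
apply: triangularD; first by apply/triangular_bracket/triangularM.
by apply: triangularZ; [apply: even_centerN1 | apply: triangular_xi].
Qed.

(** A subspace containing 1 and stable under left multiplication by the
    generators is a left ideal containing 1. *)
Lemma triangular_all x : triangular x.
Proof.
have t1 : triangular 1.
  by have := triangularM 1%g (words1 _ _) (words1 _ _); rewrite ogrp1 !mulr1.
suff: forall y, triangular y -> triangular (x * y).
  by move=> /(_ 1 t1); rewrite mulr1.
elim/odaha_ind: x => [c|[] i|w|x y IHx IHy|x y IHx IHy] z tz.
- by apply: triangularZ; first exact: even_center_scalar.
- exact: triangular_eta.
- exact: triangular_xi.
- exact: triangular_grp.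
- by rewrite mulrDl; apply: triangularD; [apply: IHx | apply: IHy].
- by rewrite -mulrA; apply/IHx/IHy.
Qed.

Lemma odaha_module_finite : module_finite Z.
Proof.
pose mono b := ordered_monomials (ogen b) (fun=> (2 * n)%N) (enum 'I_n).
pose basis := [seq x * g | x <- [seq x * y | x <- mono false, y <- mono true],
                           g <- [seq grp w | w : weyl n ty]].
have wordsP b x : gen_words b x -> zspan Z (mono b) x.
  apply: words_ordered.
  - exact: even_center1.
  - exact: even_centerN1.
  - exact: even_centerM.
  - exact: even_center_central.
  - exact: ogen_anticomm.
  - by move=> i; rewrite muln_gt0 /= (leq_ltn_trans _ (ltn_ord i)).
  - exact: ogen_integral.
exists basis => x; apply: (zspan_coef even_center0 even_centerD).
have zM := zspanM even_centerM even_center_central.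
elim: (triangular_all x) => [|y z _ IHy _ IHz|y z w wy wz]; first exact: zspan0.
  exact: zspanD.
apply: (zM); first by apply: (zM); apply: wordsP.
by apply: (zspan_mem even_center1); apply: map_f; rewrite mem_enum.
Qed.

End OddDahaStructure.

Theorem corollary5p5 (R : realType) (ty : weyl_type) (n : nat) (t u v : R[i]) :
  [/\ forall p : {mpoly R[i][n]}, weyl_invariant ty p ->
        even_center (eval_squares (@oeta _ ty n t u v) p),
      forall p : {mpoly R[i][n]}, weyl_invariant ty p ->
        even_center (eval_squares (@oxi _ ty n t u v) p)
    & module_finite (@even_center _ ty n t u v)].
Proof.
split; last exact: odaha_module_finite.
- exact: (@eval_squares_even_center _ ty n t u v true).
- exact: (@eval_squares_even_center _ ty n t u v false).
Qed.
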